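(* There exists no graph $G$ with an edge $e\in E(G)$ such that $\gamma_g(G)=2$ and $\gamma_g(G-e)=1$.
   Context: Graphs are finite, simple and undirected. A vertex dominates itself and all its neighbors. The domination game on a graph $G$ is played by two players, Dominator and Staller, who alternately choose a vertex of $G$ such that each chosen vertex dominates at least one vertex that was not dominated by the previously chosen vertices. The game ends when all vertices of $G$ are dominated. Dominator wants the total number of chosen vertices to be as small as possible, Staller wants it to be as large as possible. Assuming both play optimally, $\gamma_g(G)$ (the game domination number) is the total number of vertices chosen when Dominator moves first. $G-e$ denotes the graph obtained from $G$ by removing the edge $e$ (keeping all vertices). *)

(* Defs.v *)
From mathcomp Require Import all_boot all_order.

Set Implicit Arguments.
Unset Strict Implicit.
Unset Printing Implicit Defensive.

Record sgraph := SGraph {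
  vertex :> finType;
  adj : rel vertex;
  adj_sym : symmetric adj;
  adj_irr : irreflexive adj }.

Definition edges (G : sgraph) : {set {set G}} :=
  [set [set x; y] | x in G, y in G & adj x y].

Section RemoveEdge.
Variables (G : sgraph) (e : {set G}).

Definition remove_adj : rel G := [rel x y | adj x y && ([set x; y] != e)].

Lemma remove_adj_sym : symmetric remove_adj.
Proof. by move=> x y; rewrite /remove_adj /= adj_sym setUC. Qed.

Lemma remove_adj_irr : irreflexive remove_adj.
Proof. by move=> x; rewrite /remove_adj /= adj_irr. Qed.

Definition remove_edge : sgraph := SGraph remove_adj_sym remove_adj_irr.
End RemoveEdge.

Section DominationGame.
Variable G : sgraph.
Implicit Types (D : {set G}) (v w : G).

Definition dominated_by v : {set G} := [set w | (w == v) || adj v w].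

(* [D] is the set of vertices dominated so far; the legality of a move and the
   rest of the game depend on the past moves only through [D]. *)
Definition legal D v : bool := ~~ (dominated_by v \subset D).

Definition play D v : {set G} := D :|: dominated_by v.

Inductive player := Dominator | Staller.

(* Number of moves still to be made under optimal play from position [D], by
   backward induction. The fuel [n] bounds the number of remaining moves: each
   move enlarges [D], so [#|~: D|] is enough. As a value computed with fuel [n]
   is at most [n], the default [n] of the minimum never affects it. *)
Fixpoint moves_rec (n : nat) (p : player) D : nat :=
  if n is n'.+1 then
    if D == setT then 0
    else match p with
         | Dominator =>
             (\big[minn/n']_(v | legal D v) moves_rec n' Staller (play D v)).+1
         | Staller =>
             (\max_(v | legal D v) moves_rec n' Dominator (play D v)).+1
         end
  else 0.

Definition moves (p : player) D : nat := moves_rec #|~: D| p D.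

Definition game_dom_number : nat := moves Dominator set0.

Lemma legal_exists D : D != setT -> exists v, legal D v.
Proof.
rewrite -subTset => /subsetPn[v _ vD]; exists v.
by apply/subsetPn; exists v => //; rewrite inE eqxx.
Qed.

Lemma card_play D v : legal D v -> #|~: play D v| < #|~: D|.
Proof.
move=> lDv; apply: proper_card; rewrite properE setCS subsetUl setCS.
by rewrite subUset subxx.
Qed.

Lemma moves_rec_le n p D : moves_rec n p D <= n.
Proof.
elim: n p D => //= n IHn p D; case: ifP => // _; case: p; rewrite ltnS.
  by elim/big_rec: _ => // v m _ /(leq_trans (geq_minr _ _)).
by apply/bigmax_leqP => v _.
Qed.

Lemma bigmin_le n (P : pred G) (F : G -> nat) v :
  P v -> \big[minn/n]_(w | P w) F w <= F v.
Proof. exact: (Order.TotalTheory.bigmin_le_cond n F). Qed.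

Lemma bigmin_attained n (P : pred G) (F : G -> nat) :
    (forall v, P v -> F v <= n) -> (exists v, P v) ->
  exists2 v, P v & \big[minn/n]_(w | P w) F w = F v.
Proof.
move=> Fn [v0 Pv0]; case: (arg_minnP F Pv0) => v Pv minv; exists v => //.
apply/eqP; rewrite eqn_leq bigmin_le //=.
by elim/big_rec: _ => [|w m Pw le_m]; rewrite ?Fn // leq_min le_m minv.
Qed.

Lemma moves_rec_fuel n m p D :
  #|~: D| <= n -> #|~: D| <= m -> moves_rec n p D = moves_rec m p D.
Proof.
have full k q X : #|~: X| <= 0 -> moves_rec k q X = 0.
  rewrite leqn0 cards_eq0 -setCT (inj_eq (@setC_inj _)) => /eqP->.
  by case: k => //= k; rewrite eqxx.
elim: n m p D => [|n IHn] m p D leDn leDm; first by rewrite !full.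
case: m leDm => [|m] leDm; first by rewrite !full.
rewrite /=.
have [//|/legal_exists exl] := eqVneq D setT.
have IH q v : legal D v ->
    moves_rec n q (play D v) = moves_rec m q (play D v).
  by move/card_play => ltD; apply: IHn; rewrite -ltnS; apply: leq_trans ltD _.
case: p; congr _.+1; last by apply: eq_bigr => v; apply: IH.
have [v lv Ev] := bigmin_attained
  (fun v _ => moves_rec_le n Staller (play D v)) exl.
have [w lw Ew] := bigmin_attained
  (fun w _ => moves_rec_le m Staller (play D w)) exl.
apply/eqP; rewrite eqn_leq {1}Ew -(IH _ _ lw) {2}Ev (IH _ _ lv).
by rewrite !bigmin_le.
Qed.

Lemma movesT p : moves p setT = 0.
Proof. by rewrite /moves setCT cards0. Qed.

(* Backward-induction characterization of [moves]: Dominator's best move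
   minimizes, and Staller's best move maximizes, the length of the game. *)
Lemma moves_Dominator D : D != setT ->
  (exists2 v, legal D v & moves Dominator D = (moves Staller (play D v)).+1) /\
  (forall v, legal D v -> moves Dominator D <= (moves Staller (play D v)).+1).
Proof.
move=> DT; have exl := legal_exists DT.
have [n Dn] : exists n, #|~: D| = n.+1.
  by have [v /card_play] := exl; case: #|~: D| => // n; exists n.
have E v : legal D v -> moves_rec n Staller (play D v) = moves Staller (play D v).
  by move/card_play; rewrite Dn ltnS => le; apply: moves_rec_fuel.
rewrite /moves Dn /= (negPf DT); split=> [|v lv]; last first.
  by rewrite ltnS -/(moves _ _) -E // bigmin_le.
have [v lv ->] := bigmin_attained
  (fun v _ => moves_rec_le n Staller (play D v)) exl.
by exists v; rewrite // E.
Qed.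

Lemma moves_Staller D : D != setT ->
  (exists2 v, legal D v & moves Staller D = (moves Dominator (play D v)).+1) /\
  (forall v, legal D v -> (moves Dominator (play D v)).+1 <= moves Staller D).
Proof.
move=> DT; have [v0 lv0] := legal_exists DT.
have [n Dn] : exists n, #|~: D| = n.+1.
  by move/card_play: lv0; case: #|~: D| => // n; exists n.
have E v : legal D v ->
    moves_rec n Dominator (play D v) = moves Dominator (play D v).
  by move/card_play; rewrite Dn ltnS => le; apply: moves_rec_fuel.
rewrite /moves Dn /= (negPf DT); split=> [|v lv]; last first.
  rewrite ltnS -/(moves _ _) -E //.
  exact: (leq_bigmax_cond (F := fun v => moves_rec n _ (play D v))).
have legal_gt0 : 0 < #|legal D| by apply/card_gt0P; exists v0.
have [v lv ->] := eq_bigmax_cond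
  (fun v => moves_rec n Dominator (play D v)) legal_gt0.
by exists v; rewrite // E.
Qed.

End DominationGame.

(* Main.v *)
Require Import Defs.
From mathcomp Require Import all_boot.

(** Value 1 means that a single vertex dominates the whole graph. Deleting an edge can only shrink
    closed neighborhoods, so such a vertex of [remove_edge e] also dominates all of [G], which
    forces [game_dom_number G <= 1]. *)

Lemma moves_eq0 (G : sgraph) (p : player) (D : {set G}) :
  moves p D = 0 -> D = setT.
Proof.
have [//|DT] := eqVneq D setT.
case: p; first by have [[v _ ->]] := moves_Dominator DT.
by have [[v _ ->]] := moves_Staller DT.
Qed.

Lemma game_dom_number_le1 (G : sgraph) (v : G) :
  dominated_by v = setT -> game_dom_number G <= 1.
Proof.
move=> vT; have D0 : set0 != [set: G] by apply/eqP=> /setP/(_ v); rewrite !inE.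
have [_ /(_ v)] := moves_Dominator D0.
rewrite /play set0U vT movesT; apply.
by rewrite /legal vT subTset.
Qed.

Lemma game_dom_number_eq1 (G : sgraph) :
  game_dom_number G = 1 -> exists v : G, dominated_by v = setT.
Proof.
(* On the empty graph the game is over at once, with value 0. *)
rewrite /game_dom_number; have [->|D0] := eqVneq set0 [set: G].
  by rewrite movesT.
have [[v _ ->] _] := moves_Dominator D0.
(* No move remains after the optimal opening [v], so [v] alone dominates everything. *)
by case=> /moves_eq0; rewrite /play set0U; exists v.
Qed.

Lemma dominated_by_remove_edge (G : sgraph) (e : {set G}) (v : G) :
  @dominated_by (remove_edge e) v \subset dominated_by v.
Proof.
apply/subsetP=> w; rewrite !inE => /orP[->//|/andP[-> _]].
exact: orbT.
Qed.

Theorem mainTheorem14 :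
  ~ exists (G : sgraph) (e : {set G}),
      e \in edges G /\
      game_dom_number G = 2 /\ game_dom_number (remove_edge e) = 1.
Proof.
case=> G [e [_ [G2 /game_dom_number_eq1[v vT]]]].
suff /game_dom_number_le1 : @dominated_by G v = setT by rewrite G2.
have := dominated_by_remove_edge G e v.
(* Both graphs share their vertex set, so [vT] turns the inclusion into equality with [setT]. *)
by rewrite vT subTset => /eqP.
Qed.
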